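(* For $m_j\ge 0$, $1\le j\le k$, there holds (a) $$\sum_{i_1=1}^{n}\frac{q^{m_1i_1}}{(1-q^{i_1})^{m_1+1}}\sum_{i_2=1}^{i_1}\frac{q^{m_2i_2}}{(1-q^{i_2})^{m_2+1}}\cdots\sum_{i_k=1}^{i_{k-1}}\frac{q^{m_ki_k}}{(1-q^{i_k})^{m_k+1}}x^{i_k}$$ $$=\sum_{i\ge1}\begin{bmatrix}n\\ i\end{bmatrix}\frac{(-1)^{i-1}q^{\binom{i+1}{2}-ni}}{1-q^i}\sum_{\substack{i\ge i_1\ge\cdots\ge i_k\ge1\\ i_0=i}}(1-q^{i_k})\bigl(1-(x;q)_{i_k}\bigr)\prod_{1\le j\le k}\frac{q^{i_j}}{(1-q^{i_j})^2}\,h_{m_j-1}\!\left(\frac{q^{i_j}}{1-q^{i_j}},\dots,\frac{q^{i_{j-1}}}{1-q^{i_{j-1}}}\right);$$ (b) $$\sum_{i_1=1}^{n}\frac{q^{i_1}}{(1-q^{i_1})^{m_1+1}}\sum_{i_2=1}^{i_1}\frac{q^{i_2}}{(1-q^{i_2})^{m_2+1}}\cdots\sum_{i_k=1}^{i_{k-1}}\frac{q^{i_k}}{(1-q^{i_k})^{m_k+1}}\bigl(1-(x;q)_{i_k}\bigr)$$ $$=\sum_{i\ge1}\begin{bmatrix}n\\ i\end{bmatrix}\frac{(-1)^{i-1}q^{\binom{i+1}{2}}}{1-q^i}\sum_{\substack{i\ge i_1\ge\cdots\ge i_k\ge1\\ i_0=i}}(q^{-i_k}-1)x^{i_k}\prod_{1\le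 j\le k}\frac{q^{i_j}}{(1-q^{i_j})^2}\,h_{m_j-1}\!\left(\frac{1}{1-q^{i_j}},\dots,\frac{1}{1-q^{i_{j-1}}}\right).$$
   Context: Notation: $(x;q)_\infty=\prod_{i\ge1}(1-xq^{i-1})$, $(x;q)_n=\frac{(x;q)_\infty}{(xq^n;q)_\infty}$ for $n\in\mathbb{C}$, and $(x;q)_0=1$. The Gaussian binomial coefficient is $\begin{bmatrix}n\\ r\end{bmatrix}=\frac{[n][n-1]\cdots[n-r+1]}{[r][r-1]\cdots[1]}$ with $[n]=\frac{1-q^n}{1-q}$. The number $n$ is not restricted to positive integers: when $n\in\mathbb{C}$ is not a positive integer, a sum $\sum_{1\le i\le n}a_i$ (also written $\sum_{i=1}^{n}a_i$) is read as $\sum_{i\ge1}(a_i-a_{i+n})$, which agrees with the usual meaning for positive integers $n$. $h_k(a_1,\dots,a_N)=\sum_{1\le s_1\le\cdots\le s_k\le N}a_{s_1}\cdots a_{s_k}$ is the $k$-th complete symmetric function, $h_0=1$. The list $\frac{q^{a}}{1-q^{a}},\dots,\frac{q^{b}}{1-q^{b}}$ means the quantities $\frac{q^{s}}{1-q^{s}}$, $s=a,a+1,\dots,b$; similarly for $\frac1{1-q^a},\dots,\frac1{1-q^b}$. The inner sums on the right-hand sides run over integers $i_1,\dots,i_k$ with $i\ge i_1\ge\cdots\ge i_k\ge1$, and $i_0$ denotes $i$. Convention for $m=0$: the sum $\sum_{1\le i\le N}a_i\frac{q^i}{1-q^i}h_{m-1}\left(\frac{q^i}{1-q^i},\dots,\frac{q^N}{1-q^N}\right)$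 is treated as $a_N$ whenever $m=0$, and likewise $\sum_{1\le i\le N}a_i\frac{1}{1-q^i}h_{m-1}\left(\frac{1}{1-q^i},\dots,\frac{1}{1-q^N}\right)$ is treated as $a_N$ whenever $m=0$.
   Formalization: Identity (a) is stated for natural numbers n only, since it fails for general complex n (e.g. k=1, m_1=0, q=1/4, x=1/2, n=2πi/log q); (b) covers natural n and all complex n for which the left terms are nonsingular and the right series converges. *)

(* Defs.v *)
From HB Require Import structures.
From mathcomp Require Import all_boot all_order all_algebra.
From mathcomp Require Import all_classical all_reals all_analysis.
From mathcomp.real_closed Require Import complex.

Set Implicit Arguments.
Unset Strict Implicit.
Unset Printing Implicit Defensive.

Import Order.TTheory GRing.Theory Num.Theory.
Import numFieldNormedType.Exports.

Local Open Scope classical_set_scope.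
Local Open Scope ring_scope.

(* Limits are stated over an abstract [numClosedFieldType], because the topology
   of the complex numbers is inferred through that structure and not from the
   type [R[i]] itself. *)
Definition clim (K : numClosedFieldType) (u : nat -> K) : K := limn u.

(* [u i] is summed over i >= 1. *)
Definition csum1 (K : numClosedFieldType) (u : nat -> K) : K :=
  clim (series (fun i => u i.+1)).

Definition csummable1 (K : numClosedFieldType) (u : nat -> K) : Prop :=
  cvgn (series (fun i => u i.+1)).

Definition has_sum1 (K : numClosedFieldType) (u : nat -> K) (l : K) : Prop :=
  series (fun i => u i.+1) @ \oo --> l.

Definition hsym (K : pzRingType) (k : nat) (a : seq K) : K :=
  \sum_(s : k.-tuple 'I_(size a) | sorted leq (map val s)) \prod_(t <- s) a`_t.

(* The sum of a_i * u_i * h_(m-1)(u_i, ..., u_N) over 1 <= i <= N, read as a_N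
   when m = 0. *)
Definition hsum (K : pzRingType) (u : nat -> K) (m N : nat) (a : nat -> K) : K :=
  if m is m'.+1 then
    \sum_(1 <= i < N.+1) a i * u i * hsym m' [seq u s | s <- index_iota i N.+1]
  else a N.

Section QSeries.
Variable R : realType.

Definition cexp (z : R[i]) : R[i] :=
  ((expR (complex.Re z) * cos (complex.Im z))
    +i* (expR (complex.Re z) * sin (complex.Im z)))%C.

Definition is_nat (s : R[i]) : bool := s == (Num.truncn (complex.Re s))%:R.

(* The sum of a_i over 1 <= i <= s for a complex number s. *)
Definition gsum (s : R[i]) (a : R[i] -> R[i]) : R[i] :=
  if is_nat s then \sum_(1 <= i < (Num.truncn (complex.Re s)).+1) a i%:R
  else csum1 (fun i => a i%:R - a (i%:R + s)).

(* The base is q = cexp L, where L may be any logarithm of q; it fixes the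
   meaning of the complex powers of q. *)
Variable L : R[i].
Local Notation q := (cexp L).

Definition qpow (s : R[i]) : R[i] := cexp (s * L).

Definition qpoch_inf (x : R[i]) : R[i] :=
  clim (fun N => \prod_(1 <= i < N.+1) (1 - x * q ^+ i.-1)).

(* The finite product is the value of (x; q)_oo / (x q^s; q)_oo for natural s,
   also when x is such that this quotient is of the form 0 / 0. *)
Definition qpoch (x s : R[i]) : R[i] :=
  if is_nat s then
    \prod_(1 <= i < (Num.truncn (complex.Re s)).+1) (1 - x * q ^+ i.-1)
  else qpoch_inf x / qpoch_inf (x * qpow s).

Definition qnum (s : R[i]) : R[i] := (1 - qpow s) / (1 - q).

Definition qbinom (n : R[i]) (r : nat) : R[i] :=
  (\prod_(0 <= j < r) qnum (n - j%:R)) / (\prod_(1 <= j < r.+1) qnum j%:R).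

(* In all the nested sums below, the empty sequence gives the factor depending
   on the innermost index i_k (the argument N or s), and the head of the
   sequence is the exponent attached to the outermost summation. *)

(* The upper limit is a natural number: identity (a) fails for complex n, e.g. for
   k = 1, m_1 = 0, q = 1/4, x = 1/2, n = 2 pi i / log q, where q^n = 1 makes the
   right-hand side vanish, while x^n = -1 and the left-hand side, read as
   \sum_(i >= 1) (x^i - x^(i+n)) / (1 - q^i), is positive. *)
Fixpoint lhs_a (x : R[i]) (m : seq nat) (N : nat) : R[i] :=
  if m is m1 :: m' then
    \sum_(1 <= i < N.+1) q ^+ (m1 * i) / (1 - q ^+ i) ^+ m1.+1 * lhs_a x m' i
  else x ^+ N.

(* q^i / (1 - q^i)^2 is split as 1 / (1 - q^i) times the factor
   u_i = q^i / (1 - q^i) which [hsum] absorbs. *)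
Fixpoint inner_a (x : R[i]) (m : seq nat) (N : nat) : R[i] :=
  if m is m1 :: m' then
    hsum (fun s => q ^+ s / (1 - q ^+ s)) m1 N
         (fun i => (1 - q ^+ i)^-1 * inner_a x m' i)
  else (1 - q ^+ N) * (1 - qpoch x N%:R).

Definition rhs_a (x : R[i]) (m : seq nat) (n : R[i]) (i : nat) : R[i] :=
  qbinom n i * ((-1) ^+ i.-1 * qpow ('C(i.+1, 2)%:R - n * i%:R) / (1 - q ^+ i))
  * inner_a x m i.

Fixpoint lhs_b (x : R[i]) (m : seq nat) (s : R[i]) : R[i] :=
  if m is m1 :: m' then
    gsum s (fun t => qpow t / (1 - qpow t) ^+ m1.+1 * lhs_b x m' t)
  else 1 - qpoch x s.

(* Here q^i / (1 - q^i)^2 is split as q^i / (1 - q^i) times u_i = 1 / (1 - q^i). *)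
Fixpoint inner_b (x : R[i]) (m : seq nat) (N : nat) : R[i] :=
  if m is m1 :: m' then
    hsum (fun s => (1 - q ^+ s)^-1) m1 N
         (fun i => q ^+ i / (1 - q ^+ i) * inner_b x m' i)
  else (q ^- N - 1) * x ^+ N.

Definition rhs_b (x : R[i]) (m : seq nat) (n : R[i]) (i : nat) : R[i] :=
  qbinom n i * ((-1) ^+ i.-1 * q ^+ 'C(i.+1, 2) / (1 - q ^+ i)) * inner_b x m i.

(* For n which is not a natural number, no term of the left-hand side of (b) is
   singular and the right-hand side of (b) converges. *)
Definition admissible_b (x : R[i]) (m : seq nat) (n : R[i]) : Prop :=
  [/\ forall i : nat, (0 < i)%N -> qpow (n + i%:R) != 1,
      forall i : nat, (0 < i)%N -> x * qpow (n + i%:R) != 1 &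
      csummable1 (rhs_b x m n)].

End QSeries.

(* Main.v *)
Require Import Defs.
From HB Require Import structures.
From mathcomp Require Import all_boot all_order all_algebra.
From mathcomp Require Import all_classical all_reals all_analysis.
From mathcomp.real_closed Require Import complex.
From mathcomp Require Import ring lra zify.

(** Put [z = q^n].  Then [\prod_(j < i) (z - q^j) / (1 - q^(j+1))] is, up to
    sign, the Gaussian binomial coefficient times [q^(i(i-1)/2)], so the
    right-hand side of (b) is a Newton interpolation series in [z] at the nodes
    [1, q, q^2, ...], say [G_m(z)].  For natural [n] the left-hand side [F_m] is
    determined by its increments

      [F_m(n+1) - F_m(n) = q^(n+1) / (1 - q^(n+1))^(m_1+1) * F_m'(n+1)],

    where [m = m_1 :: m'], and the identity is proved by showing that [G_m] has
    the same increments, that is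

      [G_m(qz) - G_m(z) = qz / (1 - qz)^(m_1+1) * G_m'(qz)].

    Replacing [z] by [qz] in the Newton basis gives
    [G_m(qz) - G_m(z) = - z * D_m(z)], with [D_m] the series that has the
    coefficients of [G_m] shifted by one place ([gpart_diff]).  The complete
    symmetric functions satisfy
    [h_(k+1)(u_i, ..., u_N) = \sum_(i <= j <= N) u_j h_k(u_i, ..., u_j)]
    ([hsumS]), which says precisely that multiplying [D_m] by [1 - qz] lowers
    [m_1] by one, up to one boundary term ([dpart_lower]).  When [m_1 = 0],
    [D_m(z)] is a multiple of [G_m'(qz)] term by term ([dpart_cons0]).

    At a natural number [n] all series terminate and induction on [n] finishes
    the proof, once the case [k = 0] is known; that case is the q-binomial
    theorem ([newton_sum_pow]).  Identity (a) is the same statement for the base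
    [1/q] and another innermost factor ([newton_sum_qpoch]): passing from [q] to
    [1/q] only changes both sides by the sign [(-1)^(k + m_1 + ... + m_k)].

    For a complex [n], convergence of [G_m] at [z] is inherited by every series
    in the argument ([newton_step]).  The left-hand side is the sum of the
    differences [a_j - a_(j+n)]; the difference equation gives
    [a_(n+1) + ... + a_(n+i) = G_m(q^i z) - G_m(z)] and, for [z = 1], where [G_m]
    vanishes, [a_1 + ... + a_i = G_m(q^i)].  Hence the partial sums of the
    left-hand side are [G_m(q^i) - G_m(q^i z) + G_m(z)], and they tend to
    [G_m(z)] because a Newton series with geometrically bounded coefficients is
    continuous at 0 ([newton_continuous_at0]).  The case [k = 0] follows in the
    same way from [1 - G(qz) = (1 - xz) (1 - G(z))]. *)

Set Implicit Arguments.
Unset Strict Implicit.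
Unset Printing Implicit Defensive.

Import Order.TTheory GRing.Theory Num.Theory.
Import numFieldNormedType.Exports.

Local Open Scope ring_scope.

(** * Complete symmetric functions *)

Section CompleteSymmetric.
Variable K : comNzRingType.
Implicit Types (b u : nat -> K).

(** The complete symmetric function of degree [k] of [b 0, ..., b (c - 1)],
    expanded along the largest index of a monomial; unlike the sum over tuples it
    does not carry the number of variables in a type. *)
Fixpoint hsym_rec b (k c : nat) : K :=
  if k is k'.+1 then \sum_(0 <= j < c) b j * hsym_rec b k' j.+1 else 1.

(** A nondecreasing tuple is its last entry [j] appended to a nondecreasing
    tuple with entries at most [j].  Keeping the index type ['I_n] fixed and
    bounding the entries by a separate [c] makes this an induction on [k]. *)
Lemma sum_sorted_tuples b (n k c : nat) : (c <= n)%N ->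
  \sum_(s : k.-tuple 'I_n | sorted leq (map val s) &&
                            all (fun t => t < c)%N (map val s))
     \prod_(t <- s) b t = hsym_rec b k c.
Proof.
elim: k c => [|k IHk] c le_cn /=.
  rewrite (big_pred1 [tuple]) ?big_nil // => s /=.
  by rewrite tuple0 /= eqxx.
pose f (p : 'I_n * k.-tuple 'I_n) := [tuple of rcons p.2 p.1].
(* The inverse splits off the last entry, as the head of the reversed tuple. *)
pose g (s : k.+1.-tuple 'I_n) :=
  (thead [tuple of rev s], [tuple of rev (behead (rev s))]).
have gK : cancel g f.
  move=> s; apply: val_inj => /=.
  rewrite /thead (tnth_nth (thead s)) /= -rev_cons.
  have: size (rev s) = k.+1 by rewrite size_rev size_tuple.
  by case E: (rev s) => [//|a l] _ /=; rewrite -E revK.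
have fK : cancel f g.
  move=> [j t]; rewrite /f /g /=; congr pair.
    by rewrite /thead (tnth_nth j) /= rev_rcons.
  by apply: val_inj; rewrite /= rev_rcons /= revK.
rewrite (reindex f) /=; last by exists g => s _; [exact: fK | exact: gK].
rewrite big_mkord (big_ord_widen n (fun j => b j * hsym_rec b k j.+1)) //.
rewrite (eq_bigl (fun p : 'I_n * k.-tuple 'I_n => (p.1 < c)%N &&
    (sorted leq (map val p.2) && all (fun t => t < p.1.+1)%N (map val p.2)))).
  rewrite -(pair_big_dep (fun j : 'I_n => j < c)%N
     (fun (j : 'I_n) (t : k.-tuple 'I_n) =>
         sorted leq (map val t) && all (fun i => i < j.+1)%N (map val t))
     (fun j t => \prod_(i <- rcons t j) b i)) /=.
  apply: eq_bigr => j _; rewrite -(IHk j.+1) // mulr_sumr.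
  by apply: eq_bigr => t _; rewrite -cats1 big_cat big_seq1 /= mulrC.
move=> [j t] /=.
rewrite map_rcons all_rcons !(sorted_pairwise leq_trans) pairwise_rcons /=.
have [lt_jc|] := boolP (j < c)%N; last by rewrite andbF.
rewrite /= andbC andbA andbC; case: pairwise => //=.
apply/andb_idl => /allP lt_tj; apply/allP => i /lt_tj lt_ij.
exact: leq_ltn_trans lt_ij lt_jc.
Qed.

Lemma hsymE k (a : seq K) : hsym k a = hsym_rec (nth 0 a) k (size a).
Proof.
rewrite -(sum_sorted_tuples _ _ (leqnn _)); apply: eq_bigl => s.
by case: sorted => //=; apply/esym/allP => i /mapP[j _ ->] /=.
Qed.

Lemma eq_hsym_rec b b' k c : (forall j, (j < c)%N -> b j = b' j) ->
  hsym_rec b k c = hsym_rec b' k c.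
Proof.
elim: k c => //= k IHk c eq_b; apply: eq_big_nat => j /= lt_jc.
by rewrite eq_b // IHk // => i le_ij; apply: eq_b; lia.
Qed.

Lemma hsym_iota u k i N :
  hsym k [seq u s | s <- index_iota i N.+1] =
  hsym_rec (fun j => u (i + j)%N) k (N.+1 - i).
Proof.
rewrite hsymE size_map size_iota; apply: eq_hsym_rec => j lt_j.
by rewrite (nth_map 0%N) ?size_iota // nth_iota.
Qed.

Lemma hsym_last u k i N :
  hsym k.+1 [seq u s | s <- index_iota i N.+1] =
  \sum_(i <= j < N.+1) u j * hsym k [seq u s | s <- index_iota i j.+1].
Proof.
rewrite hsym_iota /= -[X in index_iota X N.+1]add0n big_addn; apply: eq_big_nat => j _.
rewrite hsym_iota addnC; congr (_ * hsym_rec _ _ _); lia.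
Qed.

Lemma hsym0 (a : seq K) : hsym 0 a = 1.
Proof. by rewrite hsymE. Qed.

Lemma sum_triangle (f : nat -> nat -> K) N :
  \sum_(1 <= i < N.+1) \sum_(i <= j < N.+1) f i j =
  \sum_(1 <= j < N.+1) \sum_(1 <= i < j.+1) f i j.
Proof.
elim: N => [|N IHN]; first by rewrite !big_geq.
rewrite [RHS]big_nat_recr //= -IHN [LHS]big_nat_recr //= big_nat1.
rewrite [X in _ = _ + X]big_nat_recr //= addrA -big_split /=.
by congr (_ + _); apply: eq_big_nat => i /andP[_ /ltnW le_iN]; rewrite big_nat_recr.
Qed.

(** Together with the convention for [m = 0] this recursion determines [hsum],
    and it is the form in which the complete symmetric functions enter the
    proof. *)
Lemma hsumS u m N a :
  hsum u m.+1 N a = \sum_(1 <= j < N.+1) u j * hsum u m j a.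
Proof.
case: m => [|m] /=.
  by apply: eq_bigr => j _; rewrite hsym0 mulr1 mulrC.
under eq_bigr => i _ do rewrite hsym_last mulr_sumr.
rewrite sum_triangle; apply: eq_bigr => j _; rewrite mulr_sumr.
by apply: eq_bigr => i _; ring.
Qed.

(** Used to pass from the base [q] to [q^-1], which scales the variables by
    [-1]; since [0 < N], only positive indices occur in [hsum]. *)
Lemma hsumZ (c c' : K) (u a u' a' : nat -> K) m N : (0 < N)%N ->
    (forall i, (0 < i)%N -> u' i = c * u i) ->
    (forall i, (0 < i)%N -> a' i = c' * a i) ->
  hsum u' m N a' = c ^+ m * c' * hsum u m N a.
Proof.
move=> N0 Eu Ea; elim: m N N0 => [|m IHm] N N0.
  by rewrite /= Ea // expr0 mul1r.
rewrite !hsumS mulr_sumr; apply: eq_big_nat => j /andP[j0 _].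
by rewrite Eu // IHm // exprS; ring.
Qed.

End CompleteSymmetric.

(** * Newton series at the powers of the base *)

Section Newton.
Variables (K : fieldType) (q : K).
Hypotheses (q_neq0 : q != 0) (q_nroot : forall i, q ^+ i.+1 != 1).

(** For [w = q^n] this is [(-1)^i q^(i(i-1)/2)] times the Gaussian binomial
    coefficient of [n] and [i]. *)
Definition nbasis (w : K) (i : nat) : K :=
  \prod_(0 <= j < i) ((w - q ^+ j) / (1 - q ^+ j.+1)).

Lemma subq_neq0 i : 1 - q ^+ i.+1 != 0.
Proof. by rewrite subr_eq0 eq_sym. Qed.

Lemma nbasis0 w : nbasis w 0 = 1.
Proof. by rewrite /nbasis big_geq. Qed.

Lemma nbasisS w i : (1 - q ^+ i.+1) * nbasis w i.+1 = (w - q ^+ i) * nbasis w i.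
Proof.
by rewrite /nbasis big_nat_recr //= mulrCA [_ * (_ / _)]mulrC divfK ?subq_neq0 // mulrC.
Qed.

Lemma nbasisMq w i :
  (1 - q ^+ i.+1) * nbasis (q * w) i.+1 = - q ^+ i * (1 - q * w) * nbasis w i.
Proof.
elim: i => [|i IHi]; first by rewrite nbasisS !nbasis0 expr0; ring.
apply: (mulfI (subq_neq0 i)); rewrite nbasisS mulrCA IHi.
rewrite [RHS]mulrCA nbasisS exprS; ring.
Qed.

(** Taking the q-difference and dividing by [- w] lowers the index of the Newton
    basis by one, as the derivative does with the powers [w^i / i!]. *)
Lemma nbasis_diff w i :
  nbasis (q * w) i.+1 - nbasis w i.+1 = - w * nbasis w i.
Proof.
apply: (mulfI (subq_neq0 i)); rewrite mulrBr nbasisMq nbasisS exprS; ring.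
Qed.

Lemma nbasis_node N i : (N < i)%N -> nbasis (q ^+ N) i = 0.
Proof.
move=> lt_Ni; rewrite /nbasis (@big_cat_nat _ _ _ N.+1) //= big_nat_recr //=.
by rewrite subrr mul0r mulr0 mul0r.
Qed.

(** The left-hand side of (b) for a natural upper limit, over an arbitrary base
    and with an arbitrary innermost factor [f], so that (a) is an instance too. *)
Fixpoint nested_sum (f : nat -> K) (m : seq nat) (N : nat) : K :=
  if m is m1 :: m' then
    \sum_(1 <= i < N.+1) q ^+ i / (1 - q ^+ i) ^+ m1.+1 * nested_sum f m' i
  else f N.

(** The inner sum of the right-hand side of (b), with [y N] in place of
    [x ^+ N]. *)
Fixpoint inner_sum (y : nat -> K) (m : seq nat) (N : nat) : K :=
  if m is m1 :: m' then
    hsum (fun s => (1 - q ^+ s)^-1) m1 N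
         (fun i => q ^+ i / (1 - q ^+ i) * inner_sum y m' i)
  else (q ^- N - 1) * y N.

Arguments inner_sum : simpl never.

Lemma inner_sum_cons y m1 m N : inner_sum y (m1 :: m) N =
  hsum (fun s => (1 - q ^+ s)^-1) m1 N
       (fun i => q ^+ i / (1 - q ^+ i) * inner_sum y m i).
Proof. by []. Qed.

Definition ncoef y m i : K := - (q ^+ i / (1 - q ^+ i)) * inner_sum y m i.

Lemma inner_sum_step y m1 m i :
  inner_sum y (m1.+1 :: m) i.+1 - inner_sum y (m1.+1 :: m) i =
  (1 - q ^+ i.+1)^-1 * inner_sum y (m1 :: m) i.+1.
Proof. by rewrite !inner_sum_cons !hsumS big_nat_recr //= addrAC subrr add0r. Qed.

Lemma inner_sum0 y m1 m : inner_sum y (m1.+1 :: m) 0 = 0.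
Proof. by rewrite inner_sum_cons /= big_geq. Qed.

(** [gpart] is a partial sum of the right-hand side, and [dpart] of its
    q-difference divided by [- z]: only the index of the Newton basis differs. *)
Definition gpart y m z M := \sum_(0 <= i < M) ncoef y m i.+1 * nbasis z i.+1.
Definition dpart y m z M := \sum_(0 <= i < M) ncoef y m i.+1 * nbasis z i.

Lemma gpart_diff y m z M :
  gpart y m (q * z) M = gpart y m z M - z * dpart y m z M.
Proof.
rewrite /gpart /dpart mulr_sumr -sumrB; apply: eq_bigr => i _.
have /(canRL (subrK _)) -> := nbasis_diff z i; ring.
Qed.

(** For [m_1 = 0] the factor [1 / (1 - qz)] turns [nbasis (q * z) i.+1] into a
    multiple of [nbasis z i], by [nbasisMq]. *)
Lemma dpart_cons0 y m z M : q * z != 1 ->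
  - z * dpart y (0%N :: m) z M = q * z / (1 - q * z) * gpart y m (q * z) M.
Proof.
move=> qz1; rewrite /gpart /dpart !mulr_sumr; apply: eq_bigr => i _.
rewrite /ncoef inner_sum_cons /=.
have qz_neq0 : 1 - q * z != 0 by rewrite subr_eq0 eq_sym.
have -> : nbasis (q * z) i.+1 =
   - q ^+ i * (1 - q * z) * nbasis z i / (1 - q ^+ i.+1).
  by rewrite -nbasisMq mulrAC divff ?subq_neq0 ?mul1r.
by have := subq_neq0 i; rewrite exprS => ?; field; apply/andP.
Qed.

(** Multiplication by [1 - q * z] maps [nbasis z i] to
    [(1 - q^(i+1)) (nbasis z i - q * nbasis z i.+1)].  Summation by parts then
    takes differences of the inner sums, which by [inner_sum_step] are inner sums
    with [m_1] lowered by one.  The last term is the boundary term; it vanishes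
    at a node and tends to zero when the series converges. *)
Lemma dpart_lower y m1 m z M :
  (1 - q * z) * dpart y (m1.+1 :: m) z M.+1 = dpart y (m1 :: m) z M.+1
    - q * ((1 - q ^+ M.+1) * ncoef y (m1.+1 :: m) M.+1) * nbasis z M.+1.
Proof.
have cE n i : (1 - q ^+ i.+1) * ncoef y (n :: m) i.+1 =
              - q ^+ i.+1 * inner_sum y (n :: m) i.+1.
  by rewrite /ncoef; field; rewrite subq_neq0.
have dE i : ncoef y (m1 :: m) i.+1 =
    - q ^+ i.+1 * (inner_sum y (m1.+1 :: m) i.+1 - inner_sum y (m1.+1 :: m) i).
  by rewrite inner_sum_step /ncoef; ring.
rewrite cE /dpart; elim: M => [|M IHM].
  rewrite !big_nat1 dE inner_sum0 nbasis0.
  have := cE m1.+1 0; have := nbasisS z 0; rewrite nbasis0 expr1 expr0.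
  set u := ncoef _ _ _; set v := nbasis _ _; set w := inner_sum _ _ _ => Ev Eu.
  apply: (mulfI (subq_neq0 0)); rewrite expr1.
  transitivity ((1 - q * z) * ((1 - q) * u)); first ring.
  transitivity (- q * w * ((1 - q) - q * ((1 - q) * v))); last ring.
  by rewrite Eu Ev; ring.
rewrite big_nat_recr //= mulrDr IHM [in RHS]big_nat_recr //= dE.
have := cE m1.+1 M.+1; have := nbasisS z M.+1.
set u := ncoef _ _ _; set v := nbasis _ M.+2; set v' := nbasis _ _.
set w := inner_sum _ _ _; set w' := inner_sum _ _ _ => Ev Eu.
set S := \sum_(_ <= _ < _) _.
apply: (mulfI (subq_neq0 M.+1)).
(* [u] and [v] are exposed in the multiples to which [Eu] and [Ev] apply. *)
transitivity ((1 - q ^+ M.+2) * (S - q * (- q ^+ M.+1 * w') * v')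
   + (1 - q * z) * ((1 - q ^+ M.+2) * u) * v'); first ring.
transitivity ((1 - q ^+ M.+2) * (S - q ^+ M.+2 * (w - w') * v')
  + q * q ^+ M.+2 * w * ((1 - q ^+ M.+2) * v)); last ring.
by rewrite Eu Ev !exprS; ring.
Qed.

Definition newton_sum (y : nat -> K) M w := \sum_(0 <= i < M) y i * nbasis w i.

Lemma newton_sum_diff y M w :
  newton_sum y M.+1 (q * w) = newton_sum y M.+1 w - w * newton_sum (y \o succn) M w.
Proof.
rewrite /newton_sum mulr_sumr ![in \sum_(0 <= _ < M.+1) _]big_nat_recl //= !nbasis0.
rewrite -addrA -sumrB; congr (_ + _); apply: eq_bigr => i _.
by have /(canRL (subrK _)) -> := nbasis_diff w i; ring.
Qed.

Lemma newton_sum_mul y M w :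
  w * newton_sum y M.+1 w =
  newton_sum (fun i => (1 - q ^+ i) * y i.-1 + q ^+ i * y i) M.+1 w
  + y M * ((1 - q ^+ M.+1) * nbasis w M.+1).
Proof.
rewrite nbasisS /newton_sum; elim: M => [|M IHM].
  by rewrite !big_nat1 !nbasis0 /= expr0; ring.
rewrite big_nat_recr //= mulrDr IHM [in RHS]big_nat_recr //=.
rewrite -(nbasisS w M); ring.
Qed.

Lemma gpart_nil y z M : gpart y [::] z M = y 0%N - newton_sum y M.+1 z.
Proof.
rewrite /newton_sum big_nat_recl //= nbasis0 mulr1 opprD addNKr -sumrN.
apply: eq_bigr => i _; rewrite /ncoef /inner_sum /=; field.
by rewrite subq_neq0 expf_neq0.
Qed.

Lemma newton_sum_node y N M : (N < M)%N ->
  newton_sum y M.+1 (q ^+ N) = newton_sum y M (q ^+ N).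
Proof.
by move=> lt; rewrite /newton_sum big_nat_recr //= nbasis_node // mulr0 addr0.
Qed.

(** The finite q-binomial theorem.  Both sides are multiplied by [1 - x * q^N]
    when [N] increases by one. *)
Lemma newton_sum_pow x N M : (N <= M)%N ->
  newton_sum (fun i => x ^+ i) M.+1 (q ^+ N) =
  \prod_(1 <= i < N.+1) (1 - x * q ^+ i.-1).
Proof.
elim: N => [|N IHN] le_NM.
  rewrite big_geq // /newton_sum big_nat_recl // nbasis0.
  rewrite big1_seq /= ?mulr1 ?addr0 // => i _.
  by rewrite (@nbasis_node 0) // mulr0.
rewrite big_nat_recr //= -IHN ?(ltnW le_NM) // [q ^+ N.+1]exprS newton_sum_diff.
rewrite newton_sum_node //.
have -> : newton_sum (GRing.exp x \o succn) M (q ^+ N) =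
          x * newton_sum (GRing.exp x) M (q ^+ N).
  by rewrite /newton_sum mulr_sumr; apply: eq_bigr => i _; rewrite /= exprS mulrA.
ring.
Qed.

(** The innermost case of (a), where the base is the inverse of that of the
    q-Pochhammer symbol.  By [newton_sum_diff] and [newton_sum_mul], raising
    [N] by one multiplies the left-hand side by [x], because the coefficients
    [y] satisfy [y_(i+1) = y_i (1 - x q^-i)]. *)
Lemma newton_sum_qpoch x N M : (N <= M)%N ->
  newton_sum (fun i => \prod_(1 <= j < i.+1) (1 - x * q ^- j.-1)) M.+1
    (q ^+ N) = x ^+ N.
Proof.
set y := fun i => _.
have yS i : y i.+1 = y i * (1 - x * q ^- i) by rewrite /y big_nat_recr.
elim: N => [|N IHN] le_NM.
  rewrite /newton_sum big_nat_recl // nbasis0 /y big_geq //.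
  rewrite big1_seq /= ?mulr1 ?addr0 // => i _.
  by rewrite (@nbasis_node 0) // mulr0.
rewrite [q ^+ N.+1]exprS newton_sum_diff exprS -IHN ?(ltnW le_NM) //.
case: M le_NM {IHN} => // M le_NM; rewrite (newton_sum_node y le_NM).
rewrite newton_sum_mul nbasis_node ?(mulr0, addr0) //.
suff -> : newton_sum (fun i => (1 - q ^+ i) * (y \o succn) i.-1 +
                               q ^+ i * (y \o succn) i) M.+1 (q ^+ N) =
          (1 - x) * newton_sum y M.+1 (q ^+ N) by ring.
rewrite /newton_sum mulr_sumr; apply: eq_bigr => -[|i] _ /=; rewrite !yS.
  by rewrite !expr0 invr1; ring.
by rewrite exprS; field; rewrite q_neq0 expf_neq0.
Qed.

Lemma dpart_node y m1 m z M : q * z != 1 -> nbasis z M.+1 = 0 ->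
  (1 - q * z) ^+ m1 * dpart y (m1 :: m) z M.+1 = dpart y (0%N :: m) z M.+1.
Proof.
move=> qz1 nb0; elim: m1 => [|m1 IH]; first by rewrite expr0 mul1r.
by rewrite exprSr -mulrA dpart_lower nb0 mulr0 subr0.
Qed.

Lemma gpart_step_node y m1 m N M : (N < M)%N ->
  gpart y (m1 :: m) (q ^+ N.+1) M = gpart y (m1 :: m) (q ^+ N) M
  + q ^+ N.+1 / (1 - q ^+ N.+1) ^+ m1.+1 * gpart y m (q ^+ N.+1) M.
Proof.
case: M => // M lt_NM; have qN := subq_neq0 N; have qN1 := q_nroot N.
have /(dpart_node y m1 m) : q * q ^+ N != 1 by rewrite -exprS.
move=> /(_ M); rewrite nbasis_node // => /(_ erefl).
have := @dpart_cons0 y m (q ^+ N) M.+1; rewrite -!exprS => /(_ qN1) E0 E1.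
rewrite [in LHS]exprS gpart_diff; congr (_ + _).
apply: (mulfI (expf_neq0 m1 qN)).
rewrite -mulNr mulrCA E1 E0 [_ ^+ m1.+1]exprS; move: (q ^+ N.+1) qN => Q qN.
by field; rewrite expf_neq0 // qN.
Qed.

(** The innermost hypothesis [base] is required at positive nodes only: in (a)
    it fails at [n = 0], where the series vanishes and [x ^+ n] is 1. *)
Lemma gpart_node y f m N M :
    (forall n p, (0 < n <= p)%N -> gpart y [::] (q ^+ n) p = f n) ->
    (0 < size m + N)%N -> (N <= M)%N ->
  gpart y m (q ^+ N) M = nested_sum f m N.
Proof.
move=> base; elim: m N => [|m1 m IHm] N.
  by rewrite add0n => N0 NM; rewrite base ?N0.
move=> _; elim: N => [|N IHN] le_NM.
  rewrite /= big_geq // /gpart big1_seq // => i _.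
  by rewrite (@nbasis_node 0) // mulr0.
rewrite gpart_step_node // IHN ?(ltnW le_NM) // IHm ?addnS //.
by rewrite [RHS]/= big_nat_recr.
Qed.

End Newton.

Arguments inner_sum {K} q y m N : simpl never.

(** * The identities for natural upper limits *)

Lemma has_sum1_finite (K : numClosedFieldType) (u : nat -> K) l N :
  (forall M, (N <= M)%N -> \sum_(0 <= i < M) u i.+1 = l) -> has_sum1 u l.
Proof. by move=> El; apply: cvg_near_cst; exists N. Qed.

Section Base.
Variables (R : realType) (L : R[i]).
Local Notation q := (cexp L).

Lemma cexpD (a b : R[i]) : cexp (a + b) = cexp a * cexp b.
Proof.
case: a b => [a1 a2] [b1 b2]; rewrite /cexp /= expRD cosD sinD; simpc.
congr (Complex _ _); ring.
Qed.

Lemma cexp0 : cexp (0 : R[i]) = 1.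
Proof. by rewrite /cexp /= expR0 cos0 sin0 mulr1 mulr0. Qed.

Lemma cexp_neq0 (a : R[i]) : cexp a != 0.
Proof.
apply/eqP => a0; have := cexpD a (- a); rewrite subrr cexp0 a0 mul0r.
by move/eqP; rewrite oner_eq0.
Qed.

Lemma qpowD s t : qpow L (s + t) = qpow L s * qpow L t.
Proof. by rewrite /qpow mulrDl cexpD. Qed.

Lemma qpow_nat N : qpow L N%:R = q ^+ N.
Proof.
elim: N => [|N IHN]; first by rewrite /qpow mul0r cexp0.
by rewrite -addn1 natrD qpowD IHN /qpow mul1r exprD expr1.
Qed.

Lemma qpow_neq0 s : qpow L s != 0.
Proof. exact: cexp_neq0. Qed.

Lemma qpowB s t : qpow L (s - t) = qpow L s / qpow L t.
Proof.
by apply: (mulIf (qpow_neq0 t)); rewrite divfK ?qpow_neq0 // -qpowD subrK.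
Qed.

Lemma truncn_Re_nat N : Num.truncn (complex.Re (N%:R : R[i])) = N.
Proof. by rewrite raddfMn /= natrK. Qed.

Lemma is_nat_nat N : is_nat (N%:R : R[i]).
Proof. by rewrite /is_nat truncn_Re_nat. Qed.

Lemma gsum_nat N a : gsum (N%:R : R[i]) a = \sum_(1 <= i < N.+1) a i%:R.
Proof. by rewrite /gsum is_nat_nat truncn_Re_nat. Qed.

Lemma qpoch_nat x N : qpoch L x N%:R = \prod_(1 <= i < N.+1) (1 - x * q ^+ i.-1).
Proof. by rewrite /qpoch is_nat_nat truncn_Re_nat. Qed.

Lemma lhs_b_nat x m N :
  lhs_b L x m N%:R =
  nested_sum q (fun N => 1 - \prod_(1 <= i < N.+1) (1 - x * q ^+ i.-1)) m N.
Proof.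
elim: m N => [|m1 m IHm] N /=; first by rewrite qpoch_nat.
by rewrite gsum_nat; apply: eq_bigr => i _; rewrite qpow_nat IHm.
Qed.

Lemma inner_bE x m N : inner_b L x m N = inner_sum q (fun i => x ^+ i) m N.
Proof.
elim: m N => [//|m1 m IHm] N; rewrite inner_sum_cons /=.
by congr hsum; apply/funext => i; rewrite IHm.
Qed.

Hypothesis q_lt1 : `|q| < 1.

Lemma q_neq0 : q != 0. Proof. exact: cexp_neq0. Qed.

Lemma q_nroot i : q ^+ i.+1 != 1.
Proof.
apply/eqP => /(congr1 Num.norm); rewrite normrX normr1 => /eqP.
by rewrite lt_eqF // exprn_ilt1.
Qed.
Local Notation subq0 := (subq_neq0 q_nroot).

Lemma nbasis_qbinom n i :
  nbasis q (qpow L n) i = (-1) ^+ i * q ^+ 'C(i, 2) * qbinom L n i.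
Proof.
elim: i => [|i IHi]; first by rewrite nbasis0 /qbinom !big_geq // !mul1r invr1.
apply: (mulfI (subq0 i)); rewrite (nbasisS q_nroot) IHi.
have -> : qbinom L n i.+1 = qbinom L n i * (qnum L (n - i%:R) / qnum L i.+1%:R).
  by rewrite /qbinom (big_nat_recr i) //= (big_nat_recr i.+1) //= invfM; ring.
rewrite /qnum qpowB !qpow_nat binS bin1 exprD [(-1) ^+ i.+1]exprS.
by field; rewrite subq0 expf_neq0 ?q_neq0 ?andbT //=; have := subq0 0; rewrite expr1.
Qed.

Lemma rhs_bE x m n i :
  rhs_b L x m n i.+1 =
  ncoef q (fun i => x ^+ i) m i.+1 * nbasis q (qpow L n) i.+1.
Proof.
rewrite /rhs_b /ncoef inner_bE nbasis_qbinom binS bin1 exprD /= [(-1) ^+ i.+1]exprS.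
by ring.
Qed.

Lemma has_sum1_rhs_b_nat x m N :
  has_sum1 (rhs_b L x m N%:R) (lhs_b L x m N%:R).
Proof.
have base n p : (n <= p)%N -> gpart q (fun i => x ^+ i) [::] (q ^+ n) p =
    1 - \prod_(1 <= i < n.+1) (1 - x * q ^+ i.-1).
  by move=> np; rewrite (gpart_nil q_neq0 q_nroot) newton_sum_pow //; exact: q_nroot.
apply: (@has_sum1_finite _ _ _ N) => M le_NM.
under eq_bigr => i _ do rewrite rhs_bE qpow_nat.
rewrite -/(gpart q _ m (q ^+ N) M) lhs_b_nat.
case: m => [|m1 m]; first exact: base.
apply: gpart_node => // [|n p /andP[_ np]]; [exact: q_nroot | exact: base].
Qed.

Local Notation p := (q^-1).

Lemma p_nroot i : p ^+ i.+1 != 1.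
Proof. by rewrite exprVn invr_eq1 q_nroot. Qed.

(** In terms of [p = q^-1], the factor [q^(m i) / (1 - q^i)^(m+1)] is
    [(-1)^(m+1) p^i / (1 - p^i)^(m+1)]. *)
Lemma lhs_aE x m N :
  lhs_a L x m N = (-1) ^+ (size m + sumn m) * nested_sum p (fun i => x ^+ i) m N.
Proof.
elim: m N => [|m1 m IHm] N /=; first by rewrite mul1r.
rewrite mulr_sumr; apply: eq_big_nat => -[//|i] _; rewrite IHm.
have -> : q ^+ (m1 * i.+1) / (1 - q ^+ i.+1) ^+ m1.+1 =
          (-1) ^+ m1.+1 * (p ^+ i.+1 / (1 - p ^+ i.+1) ^+ m1.+1).
  rewrite exprVn; have := subq0 i; have := expf_neq0 i.+1 q_neq0.
  rewrite mulnC exprM; move: (q ^+ i.+1) => Q Q0 Q1.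
  have -> : 1 - Q^-1 = - (1 - Q) / Q by field.
  rewrite !exprMn exprVn [(- (1 - Q)) ^+ _]exprNn !exprS.
  have : (-1) ^+ m1 != 0 :> R[i] by rewrite signr_eq0.
  have := expf_neq0 m1 Q0; have := expf_neq0 m1 Q1.
  move: (Q ^+ m1) ((1 - Q) ^+ m1) ((-1) ^+ m1) => A B C B0 A0 C0.
  by field; rewrite A0 Q0 B0 Q1 C0.
have -> : ((size m).+1 + (m1 + sumn m) = m1.+1 + (size m + sumn m))%N by lia.
by rewrite (exprD _ m1.+1); ring.
Qed.

(** The variables [q^s / (1 - q^s)] are [- 1 / (1 - p^s)] and the weights
    [1 / (1 - q^i)] are [- p^i / (1 - p^i)]; the innermost factor contributes one
    more sign. *)
Lemma inner_aE x m N : (0 < N)%N ->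
  inner_a L x m N = (-1) ^+ (size m + sumn m).+1 *
    inner_sum p (fun N => 1 - \prod_(1 <= j < N.+1) (1 - x * p ^- j.-1)) m N.
Proof.
elim: m N => [|m1 m IHm] N N0 /=.
  have pV j : p ^- j = q ^+ j by rewrite exprVn invrK.
  rewrite expr1 /inner_sum qpoch_nat pV.
  by under [in RHS]eq_bigr => j _ do rewrite pV; ring.
set y := fun _ => _ in IHm *.
rewrite inner_sum_cons; pose c : R[i] := (-1) ^+ (size m + sumn m).+2.
transitivity ((-1) ^+ m1 * c * hsum (fun s => (1 - p ^+ s)^-1) m1 N
   (fun i => p ^+ i / (1 - p ^+ i) * inner_sum p y m i)).
  apply: hsumZ N0 _ _ => -[//|i] _.
    rewrite exprVn; have := subq0 i; have := expf_neq0 i.+1 q_neq0.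
    move: (q ^+ i.+1) => Q Q0 Q1; have -> : 1 - Q^-1 = - (1 - Q) / Q by field.
    by field; rewrite Q0.
  rewrite IHm // /c [(-1) ^+ _.+2]exprS mulrA [RHS]mulrA; congr (_ * _).
  rewrite mulrAC; congr (_ * _).
  rewrite exprVn; have := subq0 i; have := expf_neq0 i.+1 q_neq0.
  move: (q ^+ i.+1) => Q Q0 Q1; have -> : 1 - Q^-1 = - (1 - Q) / Q by field.
  by field; rewrite Q0.
by rewrite -exprD; congr (_ ^+ _ * _); lia.
Qed.

(** This is the symmetry of the Gaussian binomial coefficient under [q -> 1/q];
    the factor [q^(- N i)] is the one by which (a) differs from (b), and [q^i] is
    absorbed by [1 / (1 - q^i) = - p^i / (1 - p^i)], with [p = q^-1]. *)
Lemma nbasis_inv N i :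
  nbasis p (p ^+ N) i = qpow L (i%:R - N%:R * i%:R) * nbasis q (q ^+ N) i.
Proof.
elim: i => [|i IHi].
  by rewrite !nbasis0 mulr0 subrr /qpow mul0r cexp0 mulr1.
apply: (mulfI (subq_neq0 p_nroot i)); rewrite (nbasisS p_nroot) IHi.
have /(canRL (mulKf (subq0 i))) -> := nbasisS q_nroot (q ^+ N) i.
have -> : (i.+1%:R - N%:R * i.+1%:R : R[i]) =
   (i%:R - N%:R * i%:R) + (1%:R - N%:R) by rewrite -addn1 natrD; ring.
rewrite (qpowD _ (1%:R - N%:R)) (qpowB 1%:R) !qpow_nat !exprVn expr1 exprS.
move: (nbasis _ _ _) (qpow _ _) => B C.
have := subq0 i; have := expf_neq0 i q_neq0; have := expf_neq0 N q_neq0.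
rewrite exprS; move: (q ^+ i) (q ^+ N) q_neq0 => Q Q' q0 Q0 Q0' Q1.
by field; rewrite Q1 Q0 Q0' q0.
Qed.

Lemma rhs_aE x m N i :
  rhs_a L x m N%:R i.+1 = (-1) ^+ (size m + sumn m) *
   (ncoef p (fun N => 1 - \prod_(1 <= j < N.+1) (1 - x * p ^- j.-1)) m i.+1
    * nbasis p (p ^+ N) i.+1).
Proof.
rewrite /rhs_a /ncoef inner_aE // nbasis_inv -(qpow_nat N) nbasis_qbinom.
rewrite binS bin1 natrD -addrA qpowD qpow_nat /= [(-1) ^+ i.+1]exprS.
rewrite [(-1) ^+ (_ + _).+1]exprS.
have := subq0 i; rewrite exprVn; have := expf_neq0 i.+1 q_neq0.
move: (q ^+ i.+1) => Q Q0 Q1; have -> : 1 - Q^-1 = - (1 - Q) / Q by field.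
by field; rewrite Q0.
Qed.

Lemma has_sum1_rhs_a x m N : (0 < size m)%N ->
  has_sum1 (rhs_a L x m N%:R) (lhs_a L x m N).
Proof.
move=> m0; have p0 : p != 0 by rewrite invr_eq0 q_neq0.
have newt1 n k : (0 < n <= k)%N -> newton_sum p (fun=> 1) k.+1 (p ^+ n) = 0.
  case: n => // n /andP[_ nk].
  have <- : newton_sum p (fun i => 1 ^+ i) k.+1 (p ^+ n.+1) =
            newton_sum p (fun=> 1) k.+1 (p ^+ n.+1).
    by apply: eq_bigr => i _; rewrite expr1n.
  by rewrite (newton_sum_pow p_nroot) // big_nat_recl //= expr0 mulr1 subrr mul0r.
apply: (@has_sum1_finite _ _ _ N) => M le_NM.
under eq_bigr => i _ do rewrite rhs_aE.
rewrite -mulr_sumr -/(gpart p _ m (p ^+ N) M) lhs_aE; congr (_ * _).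
apply: gpart_node => // [|n k nk|]; [exact: p_nroot | | by rewrite addn_gt0 m0].
rewrite (gpart_nil p0 p_nroot) big_geq // subrr.
have /andP[_ lt_nk] := nk; rewrite -(newton_sum_qpoch p0 p_nroot x lt_nk) sub0r.
apply/esym/eqP; rewrite -addr_eq0 -(newt1 _ _ nk) -big_split /=.
by apply/eqP/eq_bigr => i _; ring.
Qed.

End Base.

Arguments has_sum1_rhs_b_nat {R L} q_lt1 x m N.
Arguments has_sum1_rhs_a {R L} q_lt1 x m N.

(** * Limits of complex sequences *)

Section Tends.
Local Open Scope classical_set_scope.

Variable K : numClosedFieldType.
Implicit Types (u v : nat -> K) (a b : K).

(** Convergence is stated over an abstract [numClosedFieldType], since this is
    the structure through which the complex numbers receive their topology. *)
Definition tends u a : Prop := u @ \oo --> a.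

Lemma tends_clim u a : tends u a -> clim u = a.
Proof. by move=> ua; apply: cvg_lim => //; exact: norm_hausdorff. Qed.

Lemma tends_unique u a b : tends u a -> tends u b -> a = b.
Proof. by move=> /tends_clim <- /tends_clim. Qed.

Lemma eq_tends u v a : u =1 v -> tends u a -> tends v a.
Proof. by move=> /funext ->. Qed.

Lemma tends_cst a : tends (fun=> a) a.
Proof. exact: cvg_cst. Qed.

Lemma tendsD u v a b : tends u a -> tends v b -> tends (fun n => u n + v n) (a + b).
Proof. exact: cvgD. Qed.

Lemma tendsB u v a b : tends u a -> tends v b -> tends (fun n => u n - v n) (a - b).
Proof. exact: cvgB. Qed.

Lemma tendsM u v a b : tends u a -> tends v b -> tends (fun n => u n * v n) (a * b).
Proof. exact: cvgM. Qed.

Lemma tendsZ c u a : tends u a -> tends (fun n => c * u n) (c * a).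
Proof. exact/tendsM/tends_cst. Qed.

Lemma tendsS u a : tends (fun n => u n.+1) a <-> tends u a.
Proof. by rewrite /tends -(cvg_shiftS u). Qed.

Lemma tends_series u a : tends (series u) a -> tends u 0.
Proof.
move=> ua; rewrite -(subrr a).
have /tendsB/(_ ua) := (tendsS (series u) a).2 ua.
by apply: eq_tends => n; rewrite seriesSB.
Qed.

End Tends.

Arguments tendsZ {K} c {u a}.
Arguments tends_cst {K} a.

Section Modulus.
Local Open Scope classical_set_scope.

Variable R : realType.
Implicit Types (z w : R[i]) (u : nat -> R[i]).

(** The modulus with values in [R], which is archimedean and complete, whereas
    the norm of [R[i]] takes values in [R[i]] itself. *)
Definition cabs z : R := Normc.normc z.

Lemma cabsE z : `|z| = (cabs z)%:C%C. Proof. by []. Qed.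

Lemma cabs0 : cabs 0 = 0. Proof. exact: Normc.normc0. Qed.
Lemma cabs1 : cabs 1 = 1. Proof. exact: Normc.normc1. Qed.
Lemma cabsM z w : cabs (z * w) = cabs z * cabs w. Proof. exact: Normc.normcM. Qed.
Lemma cabsV z : cabs z^-1 = (cabs z)^-1. Proof. exact: Normc.normcV. Qed.
Lemma cabsN z : cabs (- z) = cabs z. Proof. exact: normcN. Qed.
Lemma cabsD z w : cabs (z + w) <= cabs z + cabs w. Proof. exact: le_normcD. Qed.
Lemma cabsB z w : cabs (z - w) <= cabs z + cabs w.
Proof. by rewrite -(cabsN w) cabsD. Qed.
Lemma cabs_ge0 z : 0 <= cabs z. Proof. by rewrite -lecR -cabsE normr_ge0. Qed.
Lemma cabs_gt0 z : (0 < cabs z) = (z != 0).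
Proof. by rewrite -ltcR -cabsE normr_gt0. Qed.
Lemma cabsX z n : cabs (z ^+ n) = cabs z ^+ n.
Proof. by elim: n => [|n IHn]; rewrite ?expr0 ?cabs1 // !exprS cabsM IHn. Qed.
Lemma cabs_subC z w : cabs (z - w) = cabs (w - z).
Proof. by rewrite -cabsN opprB. Qed.
Lemma cabs_sub_ge z w : cabs z - cabs w <= cabs (z - w).
Proof. by rewrite lerBlDr -{1}(subrK w z) cabsD. Qed.

Lemma cabs_sum (I : Type) (r : seq I) (P : pred I) (F : I -> R[i]) :
  cabs (\sum_(i <- r | P i) F i) <= \sum_(i <- r | P i) cabs (F i).
Proof.
elim/big_rec2: _ => [|i a z _ le_za]; first by rewrite cabs0.
by apply: le_trans (cabsD _ _) _; rewrite lerD2l.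
Qed.

Lemma cabs_Re z : `|complex.Re z| <= cabs z.
Proof. by rewrite -lecR -cabsE normc_ge_Re. Qed.

Lemma cabs_Im z : `|complex.Im z| <= cabs z.
Proof.
have := cabs_Re (z * 'i%C); rewrite cabsM.
have -> : cabs ('i%C : R[i]) = 1 by rewrite /cabs /= expr0n expr1n add0r sqrtr1.
by case: z => a b; rewrite mulr1; simpc; rewrite /= normrN.
Qed.

Lemma cabs_le z : cabs z <= `|complex.Re z| + `|complex.Im z|.
Proof.
rewrite -[leRHS]ger0_norm ?addr_ge0 // -sqrtr_sqr; case: z => a b /=.
rewrite ler_wsqrtr // sqrrD !real_normK ?num_real //.
have := mulr_ge0 (normr_ge0 a) (normr_ge0 b); lra.
Qed.

Lemma tendsP u z : tends u z <-> (cabs (u n - z) @[n --> \oo] --> 0).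
Proof.
split=> [/cvgrPdist_lt uz|/cvgr0Pnorm_lt uz].
  apply/cvgr0Pnorm_lt => e e0; have := uz e%:C%C; rewrite ltcR => /(_ e0).
  apply: filterS => n; rewrite cabsE ltcR cabs_subC => /le_lt_trans; apply.
  by rewrite ger0_norm ?cabs_ge0.
apply/cvgrPdist_lt => e; case: e => a b; rewrite ltcE /= => /andP[/eqP -> a0].
have := uz a a0; apply: filterS => n; rewrite ger0_norm ?cabs_ge0 // => ?.
by rewrite cabsE ltcR cabs_subC.
Qed.

Lemma tends_squeeze u z (v : nat -> R) :
  (forall n, cabs (u n - z) <= v n) -> v @ \oo --> 0 -> tends u z.
Proof.
move=> uv v0; apply/tendsP; apply: (squeeze_cvgr _ (cvg_cst 0) v0).
by apply: nearW => n; rewrite cabs_ge0 uv.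
Qed.

Lemma tends_cabs_le u z b : (forall n, cabs (u n) <= b) -> tends u z -> cabs z <= b.
Proof.
move=> ub /tendsP uz.
have : b + cabs (u n - z) @[n --> \oo] --> b + 0 by apply: cvgD uz; exact: cvg_cst.
rewrite addr0 => bz; rewrite -(cvg_lim _ bz) //.
apply: limr_ge; first exact: cvgP bz.
apply: nearW => n.
have := cabsB (u n) (u n - z); rewrite subKr => /le_trans; apply.
by rewrite lerD2r.
Qed.

Lemma tends_bounded u z : tends u z -> exists B, forall n, cabs (u n) <= B.
Proof.
move=> /tendsP /cvgP /cvg_seq_bounded [M [_ HM]].
exists (M + 1 + cabs z) => n; have := HM (M + 1); rewrite ltrDl ltr01 => /(_ isT n I).
move=> /=; rewrite ger0_norm ?cabs_ge0 // => le1; have := cabsD (u n - z) z.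
by rewrite subrK => /le_trans; apply; rewrite lerD2r.
Qed.

Lemma eventually_bounded u N B : (forall n, (N <= n)%N -> cabs (u n) <= B) ->
  exists B', forall n, cabs (u n) <= B'.
Proof.
move=> uB; exists (`|B| + \sum_(0 <= i < N) cabs (u i)) => n.
have S0 k : 0 <= \sum_(0 <= i < k) cabs (u i).
  by apply: sumr_ge0 => i _; exact: cabs_ge0.
have [/uB le_unB|lt_nN] := leqP N n.
  by rewrite (le_trans le_unB) // (le_trans (ler_norm B)) // lerDl.
rewrite big_mkord (bigD1 (Ordinal lt_nN)) //= addrCA lerDl addr_ge0 //.
by apply: sumr_ge0 => i _; exact: cabs_ge0.
Qed.

(** Completeness of the complex numbers enters only here, through the real and
    imaginary parts. *)
Lemma abs_summable u (v : nat -> R) :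
  (forall n, cabs (u n) <= v n) -> cvgn (series v) ->
  exists z, tends (series u) z.
Proof.
move=> uv cv.
have part (p : R[i] -> R) : (forall z, `|p z| <= cabs z) -> cvgn (series (p \o u)).
  move=> pc; apply: normed_cvg; apply: series_le_cvg cv => n //=.
    exact: le_trans (cabs_ge0 _) (uv n).
  exact: le_trans (pc _) (uv n).
have /cvg_ex[/= a ca] := part _ cabs_Re; have /cvg_ex[/= b cb] := part _ cabs_Im.
exists (a +i* b)%C; apply: (@tends_squeeze _ _ (fun n =>
  `|series (complex.Re (R:=R) \o u) n - a| + `|series (complex.Im (R:=R) \o u) n - b|)).
  move=> n; apply: le_trans (cabs_le _) _; rewrite !raddfB /= /series /= !raddf_sum.
  exact: lexx.
by rewrite -[0]addr0; apply: cvgD; apply/norm_cvg0P/subr_cvg0.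
Qed.

Lemma geometric_summable (C r : R) : 0 <= r < 1 -> cvgn (series (fun n => C * r ^+ n)).
Proof. by move=> /andP[r0 r1]; apply: is_cvg_geometric_series; rewrite ger0_norm. Qed.

End Modulus.

(** * Convergence and continuity of Newton series *)

Section Growth.
Local Open Scope classical_set_scope.

Variables (R : realType) (q : R[i]).
Hypotheses (q_neq0 : q != 0) (q_lt1 : cabs q < 1).
Hypothesis q_nroot : forall i, q ^+ i.+1 != 1.
Local Notation rho := (cabs q).

Lemma rho_gt0 : 0 < rho. Proof. by rewrite cabs_gt0. Qed.
Let rho_ge0 : 0 <= rho. Proof. exact: cabs_ge0. Qed.

Lemma rhoX_le1 i : rho ^+ i <= 1.
Proof. by rewrite exprn_ile1 // ltW. Qed.

Lemma rho_cvg0 : rho ^+ n @[n --> \oo] --> 0.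
Proof. by apply: cvg_expr; rewrite ger0_norm. Qed.

Lemma rho_small (e : R) : 0 < e -> exists N, forall i, (N <= i)%N -> rho ^+ i <= e.
Proof.
move=> e0; have /cvgr0Pnorm_le/(_ _ e0)[N _ HN] := rho_cvg0.
by exists N => i /HN /=; rewrite ger0_norm ?exprn_ge0.
Qed.

Lemma tends_qX : tends (fun n => q ^+ n) 0.
Proof.
by apply: tends_squeeze rho_cvg0 => n; rewrite subr0 cabsX.
Qed.

Lemma cabs_subq i : 1 - rho <= cabs (1 - q ^+ i.+1).
Proof.
apply: le_trans (cabs_sub_ge _ _); rewrite cabs1 cabsX exprS lerD2l lerN2.
by rewrite ler_piMr // rhoX_le1.
Qed.

Lemma cabs_subq_inv i : cabs (1 - q ^+ i)^-1 <= (1 - rho)^-1.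
Proof.
case: i => [|i].
  by rewrite expr0 subrr invr0 cabs0 invr_ge0 subr_ge0 ltW.
rewrite cabsV lef_pV2 ?cabs_subq // posrE ?subr_gt0 // cabs_gt0.
by rewrite subr_eq0 eq_sym.
Qed.

(** Each application of [hsumS] costs a factor [N], absorbed by [2 ^ N]. *)
Lemma hsum_growth (U B A : R) (u a : nat -> R[i]) m : 0 <= U -> 0 <= B -> 1 <= A ->
    (forall s, cabs (u s) <= U) -> (forall i, cabs (a i) <= B * A ^+ i) ->
  exists B' A', [/\ 0 <= B', 1 <= A' &
    forall N, cabs (hsum u m N a) <= B' * A' ^+ N].
Proof.
move=> U0 B0 A1 uU aB; elim: m => [|m [B' [A' [B'0 A'1 IH]]]]; first by exists B, A.
have A'0 : 0 <= A' by exact: le_trans A'1.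
exists (U * B'), (2 * A'); split=> [||N]; [exact: mulr_ge0 | lra |].
rewrite hsumS; apply: le_trans (cabs_sum _ _ _) _.
apply: (@le_trans _ _ (\sum_(1 <= j < N.+1) U * B' * A' ^+ N)).
  rewrite ler_sum_nat // => j /andP[_ jN]; rewrite cabsM -mulrA.
  apply: ler_pM; rewrite ?cabs_ge0 ?uU //; apply: le_trans (IH j) _.
  by apply: ler_wpM2l => //; apply: ler_weXn2l.
rewrite sumr_const_nat subn1 /= exprMn -[leLHS]mulr_natr.
rewrite -[leLHS]mulrA ler_wpM2l ?mulr_ge0 // mulrC.
rewrite ler_wpM2r ?exprn_ge0 // -natrX ler_nat.
by rewrite ltnW // ltn_expl.
Qed.

Lemma ncoef_growth (x : R[i]) m : exists B A, [/\ 0 <= B, 1 <= A &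
  forall i, cabs (ncoef q (fun i => x ^+ i) m i) <= B * A ^+ i].
Proof.
pose U := (1 - rho)^-1; have U0 : 0 <= U by rewrite invr_ge0 subr_ge0 ltW.
have cU i (z : R[i]) : cabs (q ^+ i / (1 - q ^+ i) * z) <= U * cabs z.
  rewrite !cabsM ler_wpM2r ?cabs_ge0 // -[U]mul1r ler_pM ?cabs_ge0 ?cabs_subq_inv //.
  by rewrite cabsX rhoX_le1.
suff [B [A [B0 A1 HA]]] : exists B A, [/\ 0 <= B, 1 <= A &
    forall i, cabs (inner_sum q (fun i => x ^+ i) m i) <= B * A ^+ i].
  exists (U * B), A; split=> // [|i]; first exact: mulr_ge0.
  by rewrite /ncoef mulNr cabsN (le_trans (cU _ _)) // -mulrA ler_wpM2l.
elim: m => [|m1 m [B [A [B0 A1 HA]]]].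
  have r1 : 1 <= rho^-1 by rewrite invf_ge1 ?rho_gt0 // ltW.
  have x1 : 1 <= 1 + cabs x by rewrite lerDl cabs_ge0.
  (* The factor [q ^- i - 1] is at most [2 * rho ^- i]. *)
  exists 2, (rho^-1 * (1 + cabs x)); split=> // [|i].
    by rewrite -[leLHS]mulr1 ler_pM.
  rewrite /inner_sum cabsM exprMn mulrA ler_pM ?cabs_ge0 //; last first.
    by rewrite cabsX lerXn2r ?nnegrE ?cabs_ge0 ?addr_ge0 ?cabs_ge0 // lerDr.
  apply: le_trans (cabsB _ _) _; rewrite cabs1 cabsV cabsX -exprVn.
  by have := exprn_ege1 i r1; lra.
apply: (@hsum_growth U (U * B) A) => //; first exact: mulr_ge0.
- by move=> s; exact: cabs_subq_inv.
- by move=> i; rewrite (le_trans (cU _ _)) // -mulrA ler_wpM2l.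
Qed.

(** Majorant of [nbasis q w i] on the disc of radius [r]. *)
Definition nmajor (r : R) i := \prod_(0 <= j < i) ((r + rho ^+ j) / (1 - rho)).

Lemma nmajor_ge0 r i : 0 <= r -> 0 <= nmajor r i.
Proof.
move=> r0; apply: prodr_ge0 => j _.
apply: divr_ge0; first by rewrite addr_ge0 ?exprn_ge0.
by rewrite subr_ge0 ltW.
Qed.

Lemma nmajor0 r : nmajor r 0 = 1.
Proof. by rewrite /nmajor big_geq. Qed.

Lemma nmajorS r i : nmajor r i.+1 = (r + rho ^+ i) * nmajor r i / (1 - rho).
Proof. by rewrite /nmajor big_nat_recr //= mulrCA mulrA. Qed.

(** The coefficients of [nbasis q w i], as a polynomial in [w], are dominated by
    those of [nmajor r i], as a polynomial in [r].  This bounds its value by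
    [nmajor r i], and its increment from 0 by the fraction [cabs w / r] of it,
    because every power of [w] in the increment is at least the first. *)
Lemma nbasis_dist r w i : 0 < r -> cabs w <= r ->
  cabs (nbasis q w i) <= nmajor r i /\
  cabs (nbasis q w i - nbasis q 0 i) <= cabs w / r * nmajor r i.
Proof.
move=> r0 wr; have U0 : 0 < 1 - rho by rewrite subr_gt0.
elim: i => [|i [IH1 IH2]].
  rewrite !nbasis0 subrr cabs1 cabs0 /nmajor big_geq // mulr1.
  by rewrite divr_ge0 ?cabs_ge0 // ltW.
have bound (z : R[i]) b : cabs ((1 - q ^+ i.+1) * z) <= b -> cabs z <= b / (1 - rho).
  rewrite cabsM => zb; rewrite ler_pdivlMr // mulrC.
  by apply: le_trans zb; rewrite ler_wpM2r ?cabs_ge0 ?cabs_subq.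
have nm0 := nmajor_ge0 i (ltW r0).
split; rewrite nmajorS ?[_ / r * _]mulrA; apply: bound; rewrite ?mulrBr !(nbasisS q_nroot).
  rewrite cabsM ler_pM ?cabs_ge0 //; apply: le_trans (cabsB _ _) _.
  by rewrite cabsX lerD2r.
have -> : (w - q ^+ i) * nbasis q w i - (0 - q ^+ i) * nbasis q 0 i =
   w * nbasis q w i - q ^+ i * (nbasis q w i - nbasis q 0 i) by ring.
apply: le_trans (cabsB _ _) _; rewrite !cabsM cabsX.
have -> : cabs w / r * (r + rho ^+ i) * nmajor r i =
  cabs w * nmajor r i + rho ^+ i * (cabs w / r * nmajor r i).
  by field; rewrite gt_eqF.
by rewrite lerD // ler_wpM2l ?cabs_ge0 ?exprn_ge0.
Qed.

(** Consecutive terms have ratio [A (r + rho^i) / (1 - rho)].  The choice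
    [r = (1 - rho) / (4 A)] makes it at most [1/2] as soon as [rho^i <= r]. *)
Lemma nmajor_summable A : 0 < A -> exists2 r, 0 < r &
  cvgn (series (fun i => A ^+ i * nmajor r i)).
Proof.
move=> A0; have U0 : 0 < 1 - rho by rewrite subr_gt0.
pose r := (1 - rho) / (4 * A).
have r0 : 0 < r by rewrite divr_gt0 // mulr_gt0.
exists r => //; have [N HN] := rho_small r0.
pose v i := A ^+ i * nmajor r i.
have v0 i : 0 <= v i by rewrite mulr_ge0 ?exprn_ge0 ?nmajor_ge0 // ltW.
have vS i : (N <= i)%N -> v i.+1 <= v i / 2.
  move=> /HN le_r; rewrite /v nmajorS exprS.
  have -> : A * A ^+ i * ((r + rho ^+ i) * nmajor r i / (1 - rho)) =
     v i * (A * (r + rho ^+ i) / (1 - rho)) by rewrite /v; ring.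
  rewrite ler_wpM2l // ler_pdivrMr //.
  apply: (@le_trans _ _ (A * (r + r))); first by rewrite ler_wpM2l ?lerD2l // ltW.
  by rewrite /r le_eqVlt; apply/orP; left; apply/eqP; field; rewrite gt_eqF.
have vN i : v (N + i)%N <= v N * 2^-1 ^+ i.
  elim: i => [|i IHi]; first by rewrite addn0 expr0 mulr1.
  rewrite addnS exprSr mulrA; apply: le_trans (vS _ (leq_addr _ _)) _.
  by rewrite ler_wpM2r ?invr_ge0.
have cN : cvgn (series (fun i => v (N + i)%N)).
  apply: (@series_le_cvg _ _ (fun i => v N * 2^-1 ^+ i)) => // [i|].
    by rewrite mulr_ge0 ?exprn_ge0 ?invr_ge0.
  by apply: geometric_summable; lra.
have /cvg_ex[/= l cl] := cN; apply/cvg_ex; exists (series v N + l).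
rewrite -(cvg_shiftn N) /=.
have -> : (fun n => series v (n + N)%N) =
          (fun n => series v N + series (fun i => v (N + i)%N) n).
  apply/funext => n; rewrite /series /= [in LHS](@big_cat_nat _ _ _ N) //= ?leq_addl //.
  congr (_ + _); rewrite -{1}[N]add0n big_addn addnK.
  by apply: eq_bigr => i _; rewrite addnC.
by apply: cvgD => //; exact: cvg_cst.
Qed.

(** The limit [l] is the value of the series at 0.  It is the same for all
    sequences [w], which makes it possible to compare the series along two
    sequences. *)
Lemma newton_continuous_at0 (c : nat -> R[i]) B A : 0 <= B -> 1 <= A ->
    (forall i, cabs (c i) <= B * A ^+ i) ->
  exists l, forall w g, tends w 0 ->
    (forall n, has_sum1 (fun i => c i * nbasis q (w n) i) (g n)) -> tends g l.
Proof.
move=> B0 A1 cB; have A0 : 0 < A by exact: lt_le_trans A1.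
have [r r0 sumr] := nmajor_summable A0.
pose v i := B * (A ^+ i.+1 * nmajor r i.+1).
have sumv : cvgn (series v).
  have -> : series v = (fun n => B * (series (fun i => A ^+ i * nmajor r i) n.+1 - 1)).
    apply/funext => n; rewrite /series /= big_nat_recl //= nmajor0 expr0 mulr1.
    by rewrite addrC addKr mulr_sumr.
  have /cvg_ex[/= l cl] := sumr; apply/cvg_ex; exists (B * (l - 1)).
  apply: cvgM; first exact: cvg_cst.
  apply: cvgB; last exact: cvg_cst.
  by rewrite (cvg_shiftS (series (fun i => A ^+ i * nmajor r i))).
have v0 i : 0 <= v i by rewrite !mulr_ge0 ?exprn_ge0 ?nmajor_ge0 // ltW.
have [l sl] : exists l, has_sum1 (fun i => c i * nbasis q 0 i) l.
  apply: abs_summable sumv => n; rewrite cabsM /v mulrA.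
  have [] := @nbasis_dist r 0 n.+1 r0; first by rewrite cabs0 ltW.
  by move=> ? _; rewrite ler_pM ?cabs_ge0.
exists l => w g w0 sg; pose S := limn (series v).
have vS n : series v n <= S.
  apply: nondecreasing_cvgn_le => // n' m' le_nm.
  by rewrite -subr_ge0 sub_series_geq // sumr_ge0.
have dist n : cabs (w n) <= r -> cabs (g n - l) <= cabs (w n) / r * S.
  move=> wr; have /tends_cabs_le := tendsB (sg n) sl; apply => k.
  rewrite /series /= -sumrB; apply: le_trans (cabs_sum _ _ _) _.
  apply: (@le_trans _ _ (cabs (w n) / r * series v k)); last first.
    by rewrite ler_wpM2l ?divr_ge0 ?cabs_ge0 // ltW.
  rewrite /series /= mulr_sumr; apply: ler_sum => i _; rewrite -mulrBr cabsM.
  have [_ le_d] := nbasis_dist i.+1 r0 wr.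
  have := ler_pM (cabs_ge0 _) (cabs_ge0 _) (cB i.+1) le_d.
  rewrite /v; move/le_trans; apply.
  by rewrite le_eqVlt; apply/orP; left; apply/eqP; ring.
apply/tendsP; have /tendsP := w0.
under eq_fun do rewrite subr0.
move=> cw0; have cw : cabs (w n) / r * S @[n --> \oo] --> 0.
  rewrite -[0](mul0r S); apply: cvgM; last exact: cvg_cst.
  by rewrite -[0](mul0r r^-1); apply: cvgM => //; exact: cvg_cst.
apply: squeeze_cvgr (cvg_cst 0) cw.
have /cvgr0Pnorm_le/(_ _ r0) := cw0; apply: filterS => n.
by rewrite ger0_norm ?cabs_ge0 // => /dist ->.
Qed.

Implicit Types (y : nat -> R[i]) (z g d : R[i]).

Local Notation G y m z := (fun i => ncoef q y m i * nbasis q z i).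
Local Notation D y m z := (fun i => ncoef q y m i.+1 * nbasis q z i).

(** Let [t_i] be the terms of the given series and [s_i] those of the wanted
    one.  Then [z s_i = t_i - q^(i+1) t_i + q^i s_i].  Convergence bounds the
    [t_i], hence also the [s_i] because [z - q^i] stays away from 0 for large [i],
    so the last two terms are geometrically small.  This also covers the case
    that [z] is one of the nodes. *)
Lemma diff_summable y m z g : z != 0 -> has_sum1 (G y m z) g ->
  exists d, tends (series (D y m z)) d.
Proof.
move=> z0 sg; pose t i := ncoef q y m i.+1 * nbasis q z i.+1; pose s := D y m z.
have [B tB] := tends_bounded (tends_series sg : tends t 0).
have zs i : (z - q ^+ i) * s i = t i - q ^+ i.+1 * t i.
  by rewrite /s mulrCA -(nbasisS q_nroot) /t; ring.
have cz : 0 < cabs z by rewrite cabs_gt0.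
have [N HN] : exists N, forall i, (N <= i)%N -> rho ^+ i <= cabs z / 2.
  by apply: rho_small; rewrite divr_gt0.
have [C sC] : exists C, forall i, cabs (s i) <= C.
  (* [cabs (z - q ^+ i)] is at least half of [cabs z], and
     [t_i - q^(i+1) t_i] is at most [2 * B]. *)
  apply: (@eventually_bounded _ _ N (4 * B / cabs z)) => i /HN le_i.
  rewrite ler_pdivlMr //.
  have le1 : cabs (s i) * (cabs z / 2) <= 2 * B.
    apply: (@le_trans _ _ (cabs (s i) * cabs (z - q ^+ i))).
      rewrite ler_wpM2l ?cabs_ge0 //; apply: le_trans (cabs_sub_ge _ _).
      by rewrite cabsX; lra.
    rewrite -cabsM mulrC zs; apply: le_trans (cabsB _ _) _.
    rewrite cabsM cabsX; have := tB i; have := rhoX_le1 i.+1; have := cabs_ge0 (t i).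
    nra.
  by lra.
(* The part of [z * s_i] that is left after removing [t_i]. *)
pose e i := q ^+ i * s i - q ^+ i.+1 * t i.
have [e' se] : exists e', tends (series e) e'.
  apply: (@abs_summable _ _ (fun i => (C + B) * rho ^+ i)) => [i|].
    rewrite /e; apply: le_trans (cabsB _ _) _.
    rewrite (cabsM (q ^+ i)) (cabsM (q ^+ i.+1)) !cabsX mulrDl.
    apply: lerD; rewrite mulrC; first by rewrite ler_wpM2r ?exprn_ge0.
    by rewrite ler_pM ?cabs_ge0 ?exprn_ge0 // exprS ler_piMl ?exprn_ge0 // ltW.
  by apply: geometric_summable; rewrite rho_ge0.
exists (z^-1 * (g + e')).
have := tendsZ z^-1 (tendsD sg se); apply: eq_tends => n.
rewrite /series /= -big_split /= mulr_sumr; apply: eq_bigr => i _.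
apply: (mulfI z0); rewrite mulVKf // /e -[_ * nbasis q z i.+1]/(t i).
rewrite -[_ * nbasis q z i]/(s i); have := zs i; move: (t i) (s i) => a b Eab.
transitivity (a - q ^+ i.+1 * a + q ^+ i * b); first ring.
by rewrite -Eab; ring.
Qed.

(** Iterates [dpart_lower]; its boundary term is [z - q^M] times a term of the
    convergent series, hence tends to zero. *)
Lemma diff_lower y m1 m z d : tends (series (D y (m1 :: m) z)) d ->
  tends (series (D y (0%N :: m) z)) ((1 - q * z) ^+ m1 * d).
Proof.
elim: m1 d => [|m1 IH] d sd; first by rewrite expr0 mul1r.
rewrite exprSr -mulrA; apply: IH.
have s0 := tends_series sd.
have b0 : tends (fun M => (z - q ^+ M) *
    (ncoef q y (m1.+1 :: m) M.+1 * nbasis q z M)) 0.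
  by have := tendsM (tendsB (tends_cst z) tends_qX) s0; rewrite mulr0.
apply/tendsS; have := tendsD (tendsZ (1 - q * z) ((tendsS _ _).2 sd)) (tendsZ q b0).
rewrite mulr0 addr0; apply: eq_tends => M.
have := dpart_lower q_nroot y m1 m z M; rewrite /dpart /series /= => ->.
rewrite [(z - _) * _]mulrCA -(nbasisS q_nroot); ring.
Qed.

(** The q-difference equation of the right-hand side, together with the
    convergence of the series of lower depth. *)
Lemma newton_step y m1 m z g : z != 0 -> q * z != 1 -> has_sum1 (G y (m1 :: m) z) g ->
  exists2 g', has_sum1 (G y m (q * z)) g' &
    has_sum1 (G y (m1 :: m) (q * z)) (g + q * z / (1 - q * z) ^+ m1.+1 * g').
Proof.
move=> z0 qz1 sg; have [d sd] := diff_summable z0 sg.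
have qz : 1 - q * z != 0 by rewrite subr_eq0 eq_sym.
exists ((1 - q * z) / (q * z) * (- z * ((1 - q * z) ^+ m1 * d))).
  have := tendsZ ((1 - q * z) / (q * z)) (tendsZ (- z) (diff_lower sd)).
  apply: eq_tends => M; have := dpart_cons0 q_nroot y m M qz1.
  rewrite /dpart /gpart /series /= => ->.
  by field; rewrite q_neq0 z0 qz.
have -> : q * z / (1 - q * z) ^+ m1.+1 *
    ((1 - q * z) / (q * z) * (- z * ((1 - q * z) ^+ m1 * d))) = - (z * d).
  rewrite exprS; have := expf_neq0 m1 qz; move: (_ ^+ m1) => u u0.
  by field; rewrite q_neq0 z0 qz u0.
have := tendsB sg (tendsZ z sd); apply: eq_tends => M.
by have := gpart_diff q_nroot y (m1 :: m) z M; rewrite /gpart /dpart /series /=.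
Qed.

End Growth.

(** * Complex upper limits *)

Section ComplexUpperLimit.
Variables (R : realType) (L : R[i]).
Local Notation q := (cexp L).
Hypothesis q_norm_lt1 : `|q| < 1.
Implicit Types (x z g l s : R[i]).

Let q_neq0 : q != 0 := cexp_neq0 L.
Let q_lt1 : cabs q < 1.
Proof. by rewrite -ltcR -cabsE. Qed.
Let q_nroot : forall i, q ^+ i.+1 != 1 := q_nroot q_norm_lt1.

Local Notation pw x := (fun i => x ^+ i).
Local Notation G x m z := (fun i => ncoef q (pw x) m i * nbasis q z i).
Local Notation qpochn x n := (\prod_(1 <= i < n.+1) (1 - x * q ^+ i.-1)).

Lemma tends_qXl z : tends (fun n => q ^+ n * z) 0.
Proof. by have := tendsM (tends_qX q_lt1) (tends_cst z); rewrite mul0r. Qed.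

(** For [k = 0], [1 - G] is the series of the q-binomial theorem. *)
Lemma newton_nil_step x z g : has_sum1 (G x [::] z) g ->
  has_sum1 (G x [::] (q * z)) (1 - (1 - x * z) * (1 - g)).
Proof.
move=> sg.
have GE w M : series (fun i => G x [::] w i.+1) M = 1 - newton_sum q (pw x) M.+1 w.
  by have := gpart_nil q_neq0 q_nroot (pw x) w M.
have sn : tends (fun M => newton_sum q (pw x) M z) (1 - g).
  apply/tendsS; have := tendsB (tends_cst 1) sg; apply: eq_tends => M.
  by rewrite GE subKr.
have -> : 1 - (1 - x * z) * (1 - g) = g + x * z * (1 - g) by ring.
have := tendsD sg (tendsZ (x * z) sn); apply: eq_tends => M.
rewrite !GE newton_sum_diff //.
have -> : newton_sum q (pw x \o succn) M z = x * newton_sum q (pw x) M z.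
  by rewrite /newton_sum mulr_sumr; apply: eq_bigr => i _; rewrite /= exprS mulrA.
ring.
Qed.

Lemma newton_nil_iter x z g n : has_sum1 (G x [::] z) g ->
  has_sum1 (G x [::] (q ^+ n * z)) (1 - qpochn (x * z) n * (1 - g)).
Proof.
move=> sg; elim: n => [|n IHn].
  have -> : 1 - qpochn (x * z) 0 * (1 - g) = g by rewrite big_geq // mul1r subKr.
  by rewrite expr0 mul1r.
rewrite exprS -mulrA; have := newton_nil_step IHn.
suff -> : 1 - (1 - x * (q ^+ n * z)) * (1 - (1 - qpochn (x * z) n * (1 - g))) =
          1 - qpochn (x * z) n.+1 * (1 - g) by [].
by rewrite (big_nat_recr n.+1) //=; ring.
Qed.

Lemma newton_nil_at1 x : has_sum1 (G x [::] 1) 0.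
Proof.
apply: (@has_sum1_finite _ _ _ 0) => M _; rewrite big1_seq // => i _.
by rewrite (@nbasis_node _ q 0) // mulr0.
Qed.

(** Along [q^n * z] the function [1 - G] takes the values
    [(xz; q)_n (1 - G(z))], so continuity at 0 gives their limit.  For [z = 1],
    where [G] vanishes, this is the convergence of the infinite product. *)
Lemma qpoch_inf_lim x : exists2 l, tends (fun n => qpochn x n) l &
  forall z g, has_sum1 (G x [::] z) g ->
    tends (fun n => qpochn (x * z) n * (1 - g)) l.
Proof.
have [B [A [B0 A1 cB]]] := ncoef_growth q_neq0 q_lt1 q_nroot x [::].
have [l Hl] := newton_continuous_at0 q_lt1 q_nroot B0 A1 cB.
have lim z g : has_sum1 (G x [::] z) g ->
    tends (fun n => qpochn (x * z) n * (1 - g)) (1 - l).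
  move=> sg; have := Hl _ _ (tends_qXl z) (fun n => @newton_nil_iter x z g n sg).
  by move/(tendsB (tends_cst 1)); apply: eq_tends => n; rewrite subKr.
exists (1 - l) => //; have := lim _ _ (newton_nil_at1 x).
by apply: eq_tends => n; rewrite subr0 !mulr1.
Qed.

Lemma tends_qpoch x : tends (fun n => qpochn x n) (qpoch_inf L x).
Proof.
by have [l xl _] := qpoch_inf_lim x; rewrite /qpoch_inf (tends_clim xl).
Qed.

(** The q-binomial theorem for a complex exponent. *)
Lemma qpoch_inf_mul x z g : has_sum1 (G x [::] z) g ->
  qpoch_inf L (x * z) * (1 - g) = qpoch_inf L x.
Proof.
have [l xl Hl] := qpoch_inf_lim x => /Hl xzl.
rewrite -(tends_unique xl (@tends_qpoch x)); apply: tends_unique xzl.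
exact/tendsM/tends_cst/tends_qpoch.
Qed.

(** The Weierstrass product inequality. *)
Lemma prod_sub_ge (a : nat -> R[i]) n : \sum_(0 <= i < n) cabs (a i) <= 1 ->
  1 - \sum_(0 <= i < n) cabs (a i) <= cabs (\prod_(0 <= i < n) (1 - a i)).
Proof.
elim: n => [|n IHn]; first by rewrite !big_geq // subr0 cabs1.
rewrite !big_nat_recr //= cabsM; set S := \sum_(_ <= _ < _) _ => S1.
have a0 := cabs_ge0 (a n).
have S0 : 0 <= S by apply: sumr_ge0 => i _; exact: cabs_ge0.
have S_le1 : S <= 1 by lra.
have {IHn} := IHn S_le1; rewrite -/S => IHn.
have := cabs_sub_ge 1 (a n); rewrite cabs1 => le1.
apply: (@le_trans _ _ ((1 - S) * (1 - cabs (a n)))); first by nra.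
by apply: ler_pM => //; lra.
Qed.

(** By [prod_sub_ge], the factors after a large index [N] have a product of
    modulus at least [1/2]. *)
Lemma qpoch_inf_neq0 x : (forall i, x * q ^+ i != 1) -> qpoch_inf L x != 0.
Proof.
move=> xq; have r0 := rho_gt0 q_neq0; set r := cabs q in r0 *.
(* With [r ^+ N] below this bound, the moduli of [x * q ^+ i], [i >= N], have
   a sum of at most [1/2]. *)
have e0 : 0 < (1 - r) / (2 * (cabs x + 1)).
  by rewrite divr_gt0 ?subr_gt0 // mulr_gt0 // ltr_wpDl ?cabs_ge0.
have [N HN] := rho_small q_lt1 e0.
pose P n := \prod_(0 <= i < n) (1 - x * q ^+ i).
have PE n : qpochn x n = P n by rewrite big_add1.
have P0 : P N != 0.
  by rewrite prodf_seq_neq0; apply/allP => i _ /=; rewrite subr_eq0 eq_sym.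
have tail n : cabs (P N) / 2 <= cabs (P (n + N)%N).
  rewrite [P (n + N)%N]/P (@big_cat_nat _ _ _ N) //= ?leq_addl // -/(P N) cabsM.
  rewrite ler_wpM2l ?cabs_ge0 //.
  rewrite -{1}[N]add0n big_addn addnK.
  have half : \sum_(0 <= i < n) cabs (x * q ^+ (i + N)) <= 2^-1.
    rewrite (eq_bigr (fun i => cabs x * r ^+ N * r ^+ i)) => [|i _]; last first.
      by rewrite cabsM cabsX exprD; ring.
    rewrite -mulr_sumr; set S := \sum_(_ <= _ < _) _.
    have S0 : 0 <= S by apply: sumr_ge0 => i _; rewrite exprn_ge0 // ltW.
    have SE : (1 - r) * S = 1 - r ^+ n.
      by rewrite /S big_mkord -opprB mulNr -subrX1 opprB.
    have S1 : (1 - r) * S <= 1 by rewrite SE gerBl exprn_ge0 // ltW.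
    have := HN N (leqnn N).
    rewrite ler_pdivlMr ?mulr_gt0 ?ltr_wpDl ?cabs_ge0 // => /(ler_wpM2r S0).
    move/le_trans/(_ S1); have := cabs_ge0 x; have : 0 <= r ^+ N * S.
      by rewrite mulr_ge0 // exprn_ge0 // ltW.
    by move: (r ^+ N) (cabs x) => a b; lra.
  apply: le_trans (prod_sub_ge _); first by lra.
  by apply: le_trans half _; lra.
apply/eqP => lim0; have := @tends_qpoch x; rewrite lim0 => /tendsP/cvgr0Pnorm_lt.
have c0 : 0 < cabs (P N) / 2 by rewrite divr_gt0 // cabs_gt0.
move=> /(_ _ c0)[M _ /(_ (M + N)%N (leq_addr _ _))] /=.
by rewrite subr0 PE ger0_norm ?cabs_ge0 // ltNge tail.
Qed.

(** The left-hand side at natural numbers is [G(q^N)], so its limit is the value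
    of [G] at 0. *)
Lemma lhs_b_tends x m1 m : exists l, tends (fun N => lhs_b L x (m1 :: m) N%:R) l /\
  forall w g : nat -> R[i], tends w 0 ->
    (forall n, has_sum1 (G x (m1 :: m) (w n)) (g n)) -> tends g l.
Proof.
have [B [A [B0 A1 cB]]] := ncoef_growth q_neq0 q_lt1 q_nroot x (m1 :: m).
have [l Hl] := newton_continuous_at0 q_lt1 q_nroot B0 A1 cB.
exists l; split=> //; apply: Hl (tends_qX q_lt1) _ => N.
have := has_sum1_rhs_b_nat q_norm_lt1 x (m1 :: m) N; apply: eq_tends => M.
by apply: eq_bigr => i _; rewrite rhs_bE // qpow_nat.
Qed.

(** [g i] is both the sum of the series at [q^(n+i)] and [l] plus the first [i]
    terms that the left-hand side subtracts.  The terms that it adds sum up to its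
    values at natural numbers, which have the same limit as [g]. *)
Lemma lhs_b_cons x m1 m (n : R[i]) l : ~~ is_nat n ->
    (forall i, (0 < i)%N -> qpow L (n + i%:R) != 1) ->
    (forall i, (0 < i)%N -> forall l, has_sum1 (G x m (qpow L (n + i%:R))) l ->
       l = lhs_b L x m (n + i%:R)) ->
  has_sum1 (G x (m1 :: m) (qpow L n)) l -> l = lhs_b L x (m1 :: m) n.
Proof.
move=> n_nat qn IH sl.
pose a t := qpow L t / (1 - qpow L t) ^+ m1.+1 * lhs_b L x m t.
pose g i := l + \sum_(0 <= j < i) a (j.+1%:R + n).
have qpowS i : q * qpow L (n + i%:R) = qpow L (n + i.+1%:R).
  by rewrite -[i.+1]addn1 natrD addrA [in RHS]qpowD mulrC (qpow_nat L 1) expr1.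
have sg i : has_sum1 (G x (m1 :: m) (qpow L (n + i%:R))) (g i).
  elim: i => [|i IHi].
    have -> : g 0%N = l by rewrite /g big_geq // addr0.
    by rewrite addr0.
  have qi : q * qpow L (n + i%:R) != 1 by rewrite qpowS qn.
  have [g' sg' sg] := newton_step q_neq0 q_lt1 q_nroot (qpow_neq0 _ _) qi IHi.
  rewrite qpowS in sg' sg.
  have Eg := IH i.+1 isT _ sg'.
  suff -> : g i.+1 = g i + a (i.+1%:R + n) by rewrite /a [i.+1%:R + n]addrC -Eg.
  by rewrite /g big_nat_recr //= addrA.
have [b [lb bg]] := lhs_b_tends x m1 m.
have gb : tends g b.
  apply: bg sg; have := tends_qXl (qpow L n); apply: eq_tends => i.
  by rewrite qpowD qpow_nat mulrC.
rewrite /= /gsum (negPf n_nat) /csum1; apply/esym/tends_clim.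
have := tendsB (tends_cst l) (tendsB gb lb).
rewrite subrr subr0; apply: eq_tends => M.
rewrite /= gsum_nat big_add1 /g /series /= sumrB /a; ring.
Qed.

(** The second condition starts at [i = 0] because [m] may be empty, and then
    [(x; q)_n] itself occurs.  The exponents [n + i], [i >= 1], of an outer sum
    satisfy both conditions if they start at [i = 1] for [n]. *)
Lemma lhs_b_eq x m (n : R[i]) l :
    is_nat n \/ (forall i, (0 < i)%N -> qpow L (n + i%:R) != 1) /\
                (forall i, x * qpow L (n + i%:R) != 1) ->
  has_sum1 (G x m (qpow L n)) l -> l = lhs_b L x m n.
Proof.
elim: m n l => [|m1 m IHm] n l hn sl.
all: have [n_nat|n_nat] := boolP (is_nat n).
- have := has_sum1_rhs_b_nat q_norm_lt1 x [::] (Num.truncn (complex.Re n)).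
  rewrite -(eqP n_nat); apply: tends_unique.
  by move: sl; apply: eq_tends => M; apply: eq_bigr => i _; rewrite rhs_bE.
- have [|[_ xn]] := hn; first by rewrite (negPf n_nat).
  rewrite /= /qpoch (negPf n_nat) -(qpoch_inf_mul sl) mulrC mulKf ?subKr //.
  by apply: qpoch_inf_neq0 => i; rewrite -mulrA -qpow_nat -qpowD.
- have := has_sum1_rhs_b_nat q_norm_lt1 x (m1 :: m) (Num.truncn (complex.Re n)).
  rewrite -(eqP n_nat); apply: tends_unique.
  by move: sl; apply: eq_tends => M; apply: eq_bigr => i _; rewrite rhs_bE.
have [|[qn xn]] := hn; first by rewrite (negPf n_nat).
apply: lhs_b_cons sl => // i i0 l'; apply: IHm; right; split=> j.
  by rewrite -addrA -natrD => j0; rewrite qn // addn_gt0 i0.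
by rewrite -addrA -natrD.
Qed.

End ComplexUpperLimit.

Theorem theoremA (R : realType) (L x : R[i]) (k : nat) (m : k.-tuple nat)
    (hq : `|cexp L| < 1) (hk : (0 < k)%N) :
  (forall N : nat, has_sum1 (rhs_a L x m N%:R) (lhs_a L x m N)) /\
  (forall n : R[i], (exists N : nat, n = N%:R) \/ admissible_b L x m n ->
     has_sum1 (rhs_b L x m n) (lhs_b L x m n)).
Proof.
split=> [N|n [[N ->]|[qn xn sn]]].
- by apply: has_sum1_rhs_a; rewrite ?size_tuple.
- exact: has_sum1_rhs_b_nat.
have [/eqP->|n_nat] := boolP (is_nat n); first exact: has_sum1_rhs_b_nat.
have /cvg_ex[/= l sl] := sn.
suff <- : l = lhs_b L x m n by [].
have {sl} : has_sum1 (fun i => ncoef (cexp L) (fun i => x ^+ i) m i *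
                              nbasis (cexp L) (qpow L n) i) l.
  by move: sl; apply: eq_tends => M; apply: eq_bigr => i _; rewrite rhs_bE.
case: m {sn} => -[|m1 m'] /= hm; first by rewrite -(eqP hm) in hk.
apply: lhs_b_cons => // i i0 l'; apply: lhs_b_eq => //; right; split=> j.
  by rewrite -addrA -natrD => j0; rewrite qn // addn_gt0 i0.
by rewrite -addrA -natrD xn // addn_gt0 i0.
Qed.
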